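(* Let $n\geq 3$ and $s$ be positive integers such that $s\leq n$, $\gcd(n,s)=1$, $s^2\equiv 1 \pmod n$ and $s\not\equiv 1\pmod n$, and let $\tau:=\gcd(s-1,n)$. Let $D_{n,s}=\langle a,b\mid a^n=b^2=1,\ bab^{-1}=a^s\rangle$. Then the Terwilliger algebra $T(D_{n,s})$ of the group association scheme of $D_{n,s}$ (with respect to the identity element) satisfies $$\dim_{\mathbb{C}} T(D_{n,s})=\frac{n^2+3n\tau+4\tau^2}{2}.$$
   Context: For a finite group $G$ with identity $e$ and conjugacy classes $\mathrm{Cl}_0=\{e\},\mathrm{Cl}_1,\dots,\mathrm{Cl}_t$, let $A_i$ ($0\le i\le t$) be the $|G|\times|G|$ $0/1$-matrix with rows and columns indexed by $G$ and $A_i(x,y)=1$ iff $yx^{-1}\in \mathrm{Cl}_i$ (the group association scheme of $G$). Let $E_i^*$ be the diagonal $|G|\times |G|$ matrix with $E_i^*(u,u)=A_i(e,u)$, i.e. $E_i^*(u,u)=1$ iff $u\in\mathrm{Cl}_i$. The Terwilliger algebra $T(G)$ is the subalgebra of $M_{|G|}(\mathbb{C})$ generated by $A_0,\dots,A_t,E_0^*,\dots,E_t^*$. *)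

(* Defs.v *)
From mathcomp Require Import all_boot all_order all_algebra all_fingroup.
From mathcomp Require Import falgebra reals complex.

Set Implicit Arguments.
Unset Strict Implicit.
Unset Printing Implicit Defensive.

Import GRing.Theory.
Local Open Scope ring_scope.

Section GroupAssociationScheme.

Variables (F : fieldType) (gT : finGroupType) (G : {group gT}).

(* #|G|.-1.+1 is #|G|, in the successor form for which square matrices are
   canonically an F-algebra. *)
Definition group_elt (i : 'I_#|G|.-1.+1) : gT :=
  enum_val (cast_ord (prednK (cardG_gt0 G)) i).

Definition adjacency_mx (K : {set gT}) : 'M[F]_#|G|.-1.+1 :=
  \matrix_(x, y) ((group_elt y * (group_elt x)^-1)%g \in K)%:R.

(* The diagonal entry at u is the (1, u) entry of adjacency_mx K, since
   u * 1^-1 = u. *)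
Definition dual_idempotent_mx (K : {set gT}) : 'M[F]_#|G|.-1.+1 :=
  diag_mx (\row_u (group_elt u \in K)%:R).

Definition terwilliger_algebra : {aspace 'M[F]_#|G|.-1.+1} :=
  <<<<[seq adjacency_mx K | K in classes G] ++
      [seq dual_idempotent_mx K | K in classes G]>>>>%AS.

End GroupAssociationScheme.

(* Main.v *)
Require Import Defs.
From mathcomp Require Import all_boot all_order all_algebra all_fingroup.
From mathcomp Require Import falgebra reals complex.
From mathcomp Require Import cyclic zify.

(** [T(G)] always lies in the centralizer algebra of [G] acting on itself by
    conjugation, whose dimension is the number of [G]-orbits on [G * G]. The
    matrix [E_i^* A_j E_k^*] is the indicator of the pairs [(x, y)] with [x] in
    [Cl_i], [y] in [Cl_k] and [y x^-1] in [Cl_j]. If [G] has an abelian subgroup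
    [A] of index 2, each such nonempty set is a single orbit, because
    a class meeting [A] is [{d, d ^ g}] for any [g] outside [A]; so the two
    algebras coincide. By the Cauchy-Frobenius formula the number of orbits is
    the mean of [|C_G(g)|^2] over [G]. With [k = |C_A(b)|] for some [b] outside
    [A], the centralizer of [g] has order [2 |A|] for the [k] elements of
    [C_A(b)], [|A|] for the rest of [A], and [2 k] outside [A]. In [D_{n,s}],
    [A = <a>] has order [n] and [k = tau]. *)

Set Implicit Arguments.
Unset Strict Implicit.
Unset Printing Implicit Defensive.

Import GRing.Theory.

(** * Orbits of simultaneous conjugation on pairs *)

Section DiagonalConjugation.

Local Open Scope group_scope.

Variable gT : finGroupType.

Definition conj_pair (u : gT * gT) (g : gT) := (u.1 ^ g, u.2 ^ g).

Fact conj_pair_is_action : is_action [set: gT] conj_pair.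
Proof.
by apply: is_total_action => [[x y]|[x y] g h]; rewrite /conj_pair ?conjg1 ?conjgM.
Qed.

Definition conj_pair_action := Action conj_pair_is_action.

Definition conj_pair_orbits (G : {group gT}) : {set {set gT * gT}} :=
  orbit conj_pair_action G @: setX G G.

Lemma acts_conj_pair (G : {group gT}) : [acts G, on setX G G | conj_pair_action].
Proof.
apply/actsP=> g Gg [x y]; rewrite !inE /= /conj_pair /=.
by rewrite !memJ_norm // (subsetP (normG G)).
Qed.

Lemma conj_pair_orbitsP (G : {group gT}) (B : {set gT * gT}) :
  reflect (exists x y, [/\ x \in G, y \in G & B = orbit conj_pair_action G (x, y)])
          (B \in conj_pair_orbits G).
Proof.
apply: (iffP imsetP) => [[[x y] /[!inE] /andP[Gx Gy] ->]|[x [y [Gx Gy ->]]]].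
  by exists x, y.
by exists (x, y); rewrite ?inE ?Gx.
Qed.

(** The pairs fixed by [g] form the square of ['C_G[g]]. *)
Lemma card_conj_pair_orbits (G : {group gT}) :
  (#|conj_pair_orbits G| * #|G| = \sum_(g in G) #|'C_G[g]| ^ 2)%N.
Proof.
rewrite -(Frobenius_Cauchy (acts_conj_pair G)); apply: eq_bigr => g _.
rewrite -mulnn -cardsX; apply: eq_card => -[x y].
have fixE z : (z ^ g == z) = (z \in 'C[g]).
  by apply/eqP/cent1P=> [/conjg_fixP/commgP|/commgP/conjg_fixP].
by rewrite !(in_setI, in_setX) /= -!fixE [in LHS]inE sub1set inE andbACA.
Qed.

End DiagonalConjugation.

(** * Groups with an abelian subgroup of index 2 *)

Section AbelianIndexTwo.

Local Open Scope group_scope.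

Variables (gT : finGroupType) (G A : {group gT}).
Hypotheses (sAG : A \subset G) (indexA : #|G : A| = 2) (abA : abelian A).

Lemma index2_mulV x y : x \in G :\: A -> y \in G :\: A -> x * y^-1 \in A.
Proof.
move=> Dx /setDP[Gy nAy]; rewrite -mem_rcoset.
suff -> : A :* y = G :\: A by [].
apply/eqP; rewrite eqEcard card_rcoset cardsD (setIidPr sAG) -(Lagrange sAG).
rewrite indexA muln2 -addnn addnK leqnn andbT; apply/subsetP=> z.
rewrite mem_rcoset inE => Az; have := groupM (subsetP sAG _ Az) Gy.
rewrite mulgKV => ->; rewrite andbT; apply: contra nAy => zA.
by have := groupM (groupVr Az) zA; rewrite invMg invgK mulgKV.
Qed.

Lemma index2_class d d' g : d \in A -> g \in G :\: A -> d' \in d ^: G ->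
  d' = d \/ d' = d ^ g.
Proof.
move=> Ad Dg /imsetP[h Gh ->]; have [Ah|nAh] := boolP (h \in A).
  by left; apply/conjg_fixP/commgP/(centsP abA).
right; rewrite -(mulgKV g h) conjgM; congr (_ ^ g).
by apply/conjg_fixP/commgP/(centsP abA)=> //; rewrite index2_mulV // inE nAh.
Qed.

(** Once the first coordinate is moved to [x], this is the transitivity that makes the support of a
    product [E_i^* A_j E_k^*] a single orbit. *)
Lemma index2_conj_stabiliser x y y' : x \in G -> y \in G ->
    y' \in y ^: G -> y' * x^-1 \in (y * x^-1) ^: G ->
  exists2 c, c \in 'C_G[x] & y' = y ^ c.
Proof.
move=> Gx Gy Cy' Cyx.
have [Ax|nAx] := boolP (x \in A); last first.
  have Dx : x \in G :\: A by rewrite inE nAx.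
  have Zx : x \in 'C_G[x] by rewrite inE Gx cent1id.
  (* Since [x] is outside [A], one of [y] and [y * x^-1] lies in [A]; its class has at most two
     elements, exchanged by [x], which centralizes itself. *)
  suff [->|->] : y' = y \/ y' = y ^ x by [exists 1; rewrite ?conjg1 ?group1 | exists x].
  have [Ay|nAy] := boolP (y \in A); first exact: index2_class Cy'.
  have Dy : y \in G :\: A by rewrite inE nAy.
  have [] := index2_class (index2_mulV Dy Dx) Dx Cyx.
    by move/mulIg; left.
  by rewrite conjMg conjVg [x ^ x]conjgE mulKg => /mulIg; right.
have sAC : A \subset 'C_G[x].
  by rewrite subsetI sAG sub_cent1 (subsetP abA).
have [Ay|nAy] := boolP (y \in A); last first.
  have Dy : y \in G :\: A by rewrite inE nAy.
  case/imsetP: Cy' => h Gh ->; have [Ah|nAh] := boolP (h \in A).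
    by exists h => //; rewrite (subsetP sAC).
  have Dh : h \in G :\: A by rewrite inE nAh.
  (* As [y] commutes with itself, [h] may be replaced by [y^-1 * h], which lies in [A] and hence
     centralizes [x]. *)
  have Ayh : y^-1 * h \in A.
    by rewrite -[h]invgK index2_mulV // inE !groupV ?nAy ?nAh.
  exists (y^-1 * h); first by rewrite (subsetP sAC).
  by rewrite [RHS]conjgM (conjgE y y^-1) mulgV mulg1 invgK.
have [b Db] : exists b, b \in G :\: A.
  by apply/set0Pn; rewrite setD_eq0 -indexg_eq1 indexA.
have [->|eq_y'] := index2_class Ay Db Cy'; first by exists 1; rewrite ?group1 ?conjg1.
have [] := index2_class (groupM Ay (groupVr Ax)) Db Cyx.
  by move/mulIg->; exists 1; rewrite ?group1 ?conjg1.
(* Conjugation by [b] sends both [y] to [y'] and [y * x^-1] to [y' * x^-1], so it fixes [x]. *)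
rewrite conjMg conjVg eq_y' => /mulgI/invg_inj xb.
exists b => //; have [Gb _] := setDP Db.
by rewrite inE Gb cent1C; apply/cent1P/commgP/conjg_fixP.
Qed.

(** With [m = #|A|] and [k = #|'C_A[b]|], the sum is [k (2m)^2 + (m - k) m^2 + m (2k)^2]. *)
Lemma sum_card_cent1_index2 b : b \in G :\: A ->
  (2 * \sum_(g in G) #|'C_G[g]| ^ 2 =
   (#|A| ^ 2 + 3 * #|A| * #|'C_A[b]| + 4 * #|'C_A[b]| ^ 2) * #|G|)%N.
Proof.
move=> Db; have /setDP[Gb nAb] := Db.
have oG : #|G| = (#|A| * 2)%N by rewrite -(Lagrange sAG) indexA.
have sAC x : x \in A -> A \subset 'C_G[x].
  by move=> Ax; rewrite subsetI sAG sub_cent1 (subsetP abA).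
have cent_out g : g \in G :\: A -> 'C_A[g] = 'C_A[b].
  move=> Dg; apply/setP=> x; rewrite !in_setI; apply: andb_id2l => Ax.
  rewrite !(cent1C x) -(mulgKV b g) groupMl //.
  by have /setIP[] := subsetP (sAC x Ax) _ (index2_mulV Dg Db).
have C1 g : g \in 'C_A[b] -> #|'C_G[g]| = (2 * #|A|)%N.
  case/setIP=> Ag; rewrite cent1C => bg; rewrite mulnC -oG.
  congr #|pred_of_set _|; apply/setIidPl.
  apply/subsetP=> x Gx; have [/(subsetP (sAC g Ag))/setIP[]//|nAx] := boolP (x \in A).
  have Dx : x \in G :\: A by rewrite inE nAx.
  rewrite -(mulgKV b x) groupMr //.
  by have /setIP[] := subsetP (sAC g Ag) _ (index2_mulV Dx Db).
have C2 g : g \in A :\: 'C_A[b] -> #|'C_G[g]| = #|A|.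
  case/setDP=> Ag; rewrite inE Ag /= => nbg.
  congr #|pred_of_set _|; apply/eqP; rewrite eqEsubset sAC // andbT.
  apply/subsetP=> x /setIP[Gx xg]; apply: contraR nbg => nAx.
  have Dx : x \in G :\: A by rewrite inE nAx.
  rewrite cent1C -(mulgKV x b) groupMr //.
  by have /setIP[] := subsetP (sAC g Ag) _ (index2_mulV Db Dx).
(* ['C_G[g]] is the disjoint union of ['C_A[g]] and its coset by [g]. *)
have C3 g : g \in G :\: A -> #|'C_G[g]| = (2 * #|'C_A[b]|)%N.
  move=> Dg; have /setDP[Gg _] := Dg; rewrite -(cardsID A) mul2n -addnn -(cent_out g Dg).
  rewrite setIAC (setIidPr sAG); congr (_ + _)%N.
  rewrite -[RHS](card_rcoset _ g); apply: eq_card => x; rewrite mem_rcoset in_setD !in_setI.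
  have -> : (x * g^-1 \in 'C[g]) = (x \in 'C[g]) by rewrite groupMr ?groupV ?cent1id.
  case: (x \in 'C[g]); rewrite ?andbF // !andbT.
  apply/andP/idP=> [[nAx Gx]|Ax]; first by rewrite index2_mulV // inE nAx.
  have /setDP[_ nAg] := Dg; rewrite -(mulgKV g x) (groupMl _ Ax) nAg.
  by split=> //; apply: groupM Gg; apply: (subsetP sAG).
rewrite (big_setID A) /= (setIidPr sAG) (big_setID 'C_A[b]) /=.
rewrite (setIidPr (subsetIl _ _)).
rewrite (eq_bigr _ (fun g Dg => congr1 (expn^~ 2) (C1 g Dg))).
rewrite (eq_bigr _ (fun g Dg => congr1 (expn^~ 2) (C2 g Dg))).
rewrite (eq_bigr _ (fun g Dg => congr1 (expn^~ 2) (C3 g Dg))).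
rewrite !sum_nat_const !cardsD (setIidPr (subsetIl _ _)) (setIidPr sAG) oG.
have := subset_leq_card (subsetIl A 'C[b]); set k := #|'C_A[b]|; set m := #|A|.
move=> lekm; rewrite muln2 -addnn addnK.
(* This removes the truncated subtraction [m - k]. *)
have [r ->] : exists r, m = (r + k)%N by exists (m - k)%N; rewrite subnK.
rewrite addnK; lia.
Qed.

End AbelianIndexTwo.

(** * The centralizer algebra of the conjugation action *)

Section CentralizerAlgebra.

Local Open Scope ring_scope.

Variables (F : fieldType) (gT : finGroupType) (G : {group gT}).

Local Notation elt := (@group_elt gT G).
Local Notation orbits := (conj_pair_orbits G).
Local Notation to := (conj_pair_action gT).

Lemma group_elt_inj : injective elt.
Proof. by move=> i j /enum_val_inj/cast_ord_inj. Qed.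

Lemma group_eltP i : elt i \in G.
Proof. exact: enum_valP. Qed.

Lemma group_elt_surj x : x \in G -> exists i, elt i = x.
Proof.
move=> Gx; exists (cast_ord (esym (prednK (cardG_gt0 G))) (enum_rank_in Gx x)).
by rewrite /group_elt cast_ordKV enum_rankK_in.
Qed.

(** The default [i] is never reached when [g] is in [G]. *)
Definition conj_index (g : gT) (i : 'I_#|G|.-1.+1) : 'I_#|G|.-1.+1 :=
  odflt i [pick j | elt j == (elt i ^ g)%g].

Lemma conj_indexE g i : g \in G -> elt (conj_index g i) = (elt i ^ g)%g.
Proof.
move=> Gg; rewrite /conj_index; case: pickP => [j /eqP //|no].
have [|j ej] := @group_elt_surj (elt i ^ g)%g; first by rewrite groupJ ?group_eltP.
by have := no j; rewrite ej eqxx.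
Qed.

Lemma conj_index_inj g : g \in G -> injective (conj_index g).
Proof.
move=> Gg i j /(congr1 elt); rewrite !conj_indexE // => /conjg_inj.
exact: group_elt_inj.
Qed.

(** These are the matrices commuting with the permutation matrices of conjugation by [G]. *)
Definition conj_invariant (M : 'M[F]_#|G|.-1.+1) :=
  forall g, g \in G -> forall i j, M (conj_index g i) (conj_index g j) = M i j.

Lemma conj_invariantM M N :
  conj_invariant M -> conj_invariant N -> conj_invariant (M *m N).
Proof.
move=> iM iN g Gg i j; rewrite !mxE (reindex_inj (conj_index_inj Gg)).
by apply: eq_bigr => k _; rewrite iM ?iN.
Qed.

Definition orbit_mx (B : {set gT * gT}) : 'M[F]_#|G|.-1.+1 :=
  \matrix_(i, j) ((elt i, elt j) \in B)%:R.

Definition orbit_space : {vspace 'M[F]_#|G|.-1.+1} :=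
  <<[seq orbit_mx B | B in orbits]>>%VS.

Lemma orbit_pair_index g i j :
  g \in G -> (elt (conj_index g i), elt (conj_index g j)) = to (elt i, elt j) g.
Proof. by move=> Gg; rewrite !conj_indexE. Qed.

Lemma orbit_mx_invariant B : B \in orbits -> conj_invariant (orbit_mx B).
Proof.
case/conj_pair_orbitsP=> x [y [_ _ ->]] g Gg i j; rewrite !mxE orbit_pair_index //.
by rewrite orbit_actr.
Qed.

Lemma memv_orbit_space M : M \in orbit_space <-> conj_invariant M.
Proof.
split=> [/coord_span->|iM].
  move=> g Gg i j; rewrite !summxE; apply: eq_bigr => k _; rewrite !mxE.
  by rewrite nth_image (orbit_mx_invariant (enum_valP k)).
(* [c B] is the constant value of [M] on the orbit [B], read at any pair of it. *)
pose c (B : {set gT * gT}) : F :=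
  if [pick ij | (elt ij.1, elt ij.2) \in B] is Some ij then M ij.1 ij.2 else 0.
have -> : M = \sum_(B in orbits) c B *: orbit_mx B.
  apply/matrixP=> i j; rewrite summxE.
  have orbB : orbit to G (elt i, elt j) \in orbits.
    by apply/conj_pair_orbitsP; exists (elt i), (elt j); rewrite !group_eltP.
  rewrite (bigD1 _ orbB) /= big1 ?addr0 => [|B /andP[]].
    rewrite !mxE orbit_refl mulr1 /c; case: pickP => [[i' j']|no].
      case/orbitP=> g Gg [ei ej] /=; rewrite -(iM g Gg).
      by congr (M _ _); apply: group_elt_inj; rewrite conj_indexE.
    by have := no (i, j); rewrite orbit_refl.
  case/conj_pair_orbitsP=> x [y [_ _ ->]] neqB; rewrite !mxE.
  have [/orbit_eqP eqB|_] := boolP (_ \in _); last by rewrite mulr0.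
  by rewrite eqB eqxx in neqB.
by apply: memv_suml => B orbB; rewrite memvZ ?memv_span ?image_f.
Qed.

(** Distinct orbits are disjoint and nonempty, so their indicator matrices are independent. *)
Lemma dim_orbit_space : \dim orbit_space = #|orbits|.
Proof.
rewrite -(size_image orbit_mx); apply/eqP.
change (free (map_tuple orbit_mx (enum_tuple orbits))).
apply/freeP=> k sum0 i.
have /conj_pair_orbitsP[x [y [Gx Gy Bi]]] := enum_valP i.
have [[ix ex] [iy ey]] := (group_elt_surj Gx, group_elt_surj Gy).
move/matrixP/(_ ix iy): sum0; rewrite summxE (bigD1 i) //= nth_image !mxE ex ey.
rewrite Bi orbit_refl mulr1 big1 ?addr0 // => l neq_li; rewrite nth_image !mxE ex ey.
have [xyl|_] := boolP (_ \in _); last by rewrite mulr0.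
case/eqP: neq_li; apply: enum_val_inj; rewrite Bi.
have /conj_pair_orbitsP[x' [y' [_ _ Bl]]] := enum_valP l.
by move: xyl; rewrite Bl => /orbit_eqP->.
Qed.

(** The orbit space contains the identity and is stable under right multiplication by the
    generators, which are invariant because classes are. *)
Lemma terwilliger_sub_orbit_space : (terwilliger_algebra F G <= orbit_space)%VS.
Proof.
apply: agenv_sub_modr.
  rewrite -memvE; apply/memv_orbit_space => g Gg i j.
  by rewrite !mxE (inj_eq (conj_index_inj Gg)).
apply/prodvP=> M N /memv_orbit_space iM sN; apply/memv_orbit_space.
apply: (conj_invariantM iM); apply/memv_orbit_space.
apply: subvP sN; apply/span_subvP=> X.
rewrite mem_cat => /orP[]/imageP[K /imsetP[z Gz ->] ->].
all: apply/memv_orbit_space=> g Gg i j; rewrite !mxE.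
  rewrite !conj_indexE // -conjVg -conjMg.
  by rewrite (memJ_norm _ (subsetP (class_norm z G) g Gg)).
rewrite (inj_eq (conj_index_inj Gg)) conj_indexE //.
by rewrite (memJ_norm _ (subsetP (class_norm z G) g Gg)).
Qed.

Lemma orbit_space_sub_terwilliger :
    (forall x y y', x \in G -> y \in G ->
       y' \in (y ^: G)%g -> (y' * x^-1 \in (y * x^-1) ^: G)%g ->
     exists2 c, c \in 'C_G[x]%g & y' = (y ^ c)%g) ->
  (orbit_space <= terwilliger_algebra F G)%VS.
Proof.
move=> HG; apply/span_subvP=> _ /imageP[B /conj_pair_orbitsP[x [y [Gx Gy ->]]] ->].
have -> : orbit_mx (orbit to G (x, y)) =
   dual_idempotent_mx F G (x ^: G)%g * adjacency_mx F G ((y * x^-1) ^: G)%g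
     * dual_idempotent_mx F G (y ^: G)%g.
  apply/matrixP=> i j; rewrite /dual_idempotent_mx /GRing.mul /= mul_mx_diag mul_diag_mx !mxE.
  rewrite -!natrM !mulnb; congr (_%:R); congr nat_of_bool; apply/idP/idP.
    case/orbitP=> g Gg [<- <-]; rewrite -conjVg -conjMg.
    by rewrite !memJ_class.
  case/andP=> /andP[/imsetP[g Gg ei] Cji] Cj.
  have CG z K : (z ^ g^-1 \in K ^: G)%g = (z \in K ^: G)%g.
    by rewrite memJ_norm // groupV (subsetP (class_norm K G)).
  (* Conjugating back by [g] makes the first coordinate [x]; the resulting [c] fixes [x], so [c * g]
     carries [(x, y)] to the given pair. *)
  have [||c /setIP[Gc /cent1P cx] ej] := HG x y (elt j ^ g^-1)%g Gx Gy.
  - by rewrite CG.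
  - by rewrite -CG conjMg conjVg ei conjgK in Cji.
  apply/orbitP; exists (c * g)%g; rewrite ?groupM //.
  rewrite /= /conj_pair /= !conjgM -ej conjgKV ei.
  by have /commgP/conjg_fixP-> := esym cx.
have gen X : X \in [seq adjacency_mx F G K | K in classes G] ++
      [seq dual_idempotent_mx F G K | K in classes G] -> X \in terwilliger_algebra F G.
  by move=> sX; apply: (subvP (sub_agenv _)); rewrite memv_span.
by rewrite !memvM ?gen // mem_cat image_f ?orbT ?mem_classes ?groupM ?groupV.
Qed.

End CentralizerAlgebra.

Lemma dim_terwilliger_index2 (F : fieldType) (gT : finGroupType)
    (G A : {group gT}) (b : gT) :
    A \subset G -> #|G : A|%g = 2 -> abelian A -> b \in G :\: A ->
  (2 * \dim (terwilliger_algebra F G) =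
   #|A| ^ 2 + 3 * #|A| * #|'C_A[b]%g| + 4 * #|'C_A[b]%g| ^ 2)%N.
Proof.
move=> sAG iA abA Db.
have -> : \dim (terwilliger_algebra F G) = #|conj_pair_orbits G|.
  rewrite -(dim_orbit_space F); congr (\dim _); apply/eqP; rewrite eqEsubv.
  rewrite terwilliger_sub_orbit_space orbit_space_sub_terwilliger //.
  exact: index2_conj_stabiliser sAG iA abA.
apply/eqP; rewrite -(eqn_pmul2r (cardG_gt0 G)) -mulnA card_conj_pair_orbits.
by rewrite (sum_card_cent1_index2 sAG iA abA Db).
Qed.

(* The maps [i |-> i + 1] and [i |-> s i] on Z/n satisfy the relations of
   D_{n,s} and generate a group of order at least [2 n]; as a quotient of
   D_{n,s}, it shows that the presentation does not collapse. *)
Section AffinePermutations.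

Variables (n s : nat).
Hypotheses (n_gt1 : (1 < n)%N) (s2 : (s ^ 2 = 1 %[mod n])%N) (s1 : (s <> 1 %[mod n])%N).

Local Open Scope ring_scope.

Lemma sqr_multiplier : s%:R * s%:R = 1 :> 'Z_n.
Proof.
rewrite -natrM mulnn; apply: val_inj; rewrite /= !val_Zp_nat //.
by rewrite s2 modn_small.
Qed.

Lemma multiplier_inj : injective (fun i : 'Z_n => s%:R * i).
Proof. by apply: (can_inj (g := *%R s%:R)) => i; rewrite mulrA sqr_multiplier mul1r. Qed.

Definition affine_translation : {perm 'Z_n} := perm (addrI (1 : 'Z_n)).
Definition affine_multiplier : {perm 'Z_n} := perm multiplier_inj.

Local Notation a := affine_translation.
Local Notation b := affine_multiplier.

Lemma affine_translationX k i : (a ^+ k)%g i = k%:R + i.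
Proof.
elim: k i => [|k IHk] i; first by rewrite expg0 perm1 add0r.
by rewrite expgS permM permE IHk /= addrA -natr1.
Qed.

Lemma affine_relations : [/\ (a ^+ n = 1)%g, (b ^+ 2 = 1)%g & (b * a * b^-1 = a ^+ s)%g].
Proof.
have b2 : (b ^+ 2 = 1)%g.
  by apply/permP=> i; rewrite expgS expg1 permM !permE mulrA sqr_multiplier mul1r.
split=> //.
  by apply/permP=> i; rewrite affine_translationX pchar_Zp ?add0r ?perm1.
have -> : (b^-1 = b)%g by apply/eqP; rewrite eq_invg_mul -expg2 b2.
apply/permP=> i; rewrite affine_translationX !permM !permE.
by rewrite mulrDr mulr1 mulrA sqr_multiplier mul1r.
Qed.

Lemma card_affine_ge : (2 * n <= #|<[a]> <*> <[b]>|%g)%N.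
Proof.
have oa : #[a]%g = n.
  apply/eqP; rewrite eqn_dvd order_dvdn; have [-> _ _] := affine_relations.
  rewrite eqxx /=; have /permP/(_ 0) := expg_order a.
  rewrite affine_translationX perm1 addr0 => /(congr1 val).
  by rewrite /= val_Zp_nat // => /eqP.
have sAG : (<[a]> \subset <[a]> <*> <[b]>)%g by apply: joing_subl.
rewrite -(Lagrange sAG) -orderE oa mulnC leq_pmul2l; last by lia.
rewrite ltn_neqAle eq_sym indexg_eq1 join_subG subxx cycle_subG indexg_gt0 andbT.
(* If the multiplier were the translation by [k], its value at 0 would give [k = 0] and its value at
   1 then [s = 1] modulo [n]. *)
apply/negP=> /cycleP[k bk]; case: s1.
have /permP/(_ 0) := bk; rewrite affine_translationX permE mulr0 addr0 => k0.
have /permP/(_ 1) := bk; rewrite affine_translationX permE mulr1 -k0 add0r.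
by move/(congr1 val); rewrite /= val_Zp_nat // Zp_cast.
Qed.

End AffinePermutations.

(** * The structure of D_{n,s} and the dimension formula *)

Lemma presented_group_structure n s (gT : finGroupType) (G : {group gT}) :
  (1 < n)%N -> (s ^ 2 = 1 %[mod n])%N -> (s <> 1 %[mod n])%N ->
  (G \isog Grp (a : b : a ^+ n, b ^+ 2, b * a * b^-1 = a ^+ s))%g ->
  exists a b, [/\ #[a]%g = n, <[a]>%g \subset G, #|G : <[a]>|%g = 2,
     b \in G :\: <[a]>%g & (a ^ b = a ^+ s)%g].
Proof.
move=> n_gt1 s2 s1 isoG.
have leG : (2 * n <= #|G|)%N.
  apply: leq_trans (card_affine_ge n_gt1 s2 s1) _.
  apply: leq_homg; rewrite isoG.
  have [a1 b2 ab] := affine_relations n_gt1 s2.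
  apply/existsP; exists (affine_translation n, affine_multiplier n_gt1 s2).
  by rewrite /= !xpair_eqE a1 b2 ab !eqxx.
have /existsP[[a b] /=] := isoGrp_hom isoG.
rewrite !xpair_eqE => /and4P[/eqP defG /eqP a1 /eqP b2 /eqP ab].
have bV : (b^-1 = b)%g by apply/eqP; rewrite eq_invg_mul -expg2 b2.
have abs : (a ^ b = a ^+ s)%g by rewrite conjgE bV -ab bV mulgA.
have sAG : <[a]>%g \subset G by rewrite -defG joing_subl.
have Gb : b \in G by rewrite -cycle_subG -defG joing_subr.
have nab : <[b]>%g \subset 'N(<[a]>)%g.
  by rewrite norms_cycle abs mem_cycle.
(* This product is at most [n * 2]; the lower bound on [#|G|] then forces [#[a] = n] and index 2. *)
have oG : (#|G| <= #[a]%g * #[b]%g)%N.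
  by rewrite -defG norm_joinEr // mul_cardG leq_pmulr.
have le_a : (#[a]%g <= n)%N by rewrite dvdn_leq ?order_dvdn ?a1 ?eqxx //; lia.
have le_b : (#[b]%g <= 2)%N by rewrite dvdn_leq ?order_dvdn ?b2 ?eqxx.
have oa : #[a]%g = n by clear -le_a le_b leG oG n_gt1; nia.
have iA : #|G : <[a]>|%g = 2.
  have eG : #|G| = (n * 2)%N.
    apply/eqP; rewrite eqn_leq mulnC leG andbT mulnC.
    by apply: leq_trans oG _; rewrite oa leq_mul2l le_b orbT.
  by apply/eqP; rewrite -(eqn_pmul2l (ltnW n_gt1)) -eG -oa orderE Lagrange.
exists a, b; split=> //.
rewrite inE Gb andbT; apply/negP=> Ab.
move: iA; rewrite -defG (joing_idPl _) ?indexgg ?cycle_subG //.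
Qed.

(** [a ^+ i] commutes with [b] iff [n] divides [(s - 1) * i], that is, iff [n %/ t] divides [i],
    since [(s - 1) %/ t] and [n %/ t] are coprime. *)
Lemma card_cent1_cycle (gT : finGroupType) (a b : gT) n s :
  #[a]%g = n -> (0 < s)%N -> (a ^ b = a ^+ s)%g ->
  #|'C_(<[a]>)[b]%g| = gcdn (s - 1) n.
Proof.
move=> oa s_gt0 ab.
have n_gt0 : (0 < n)%N by rewrite -oa order_gt0.
set t := gcdn _ _.
have t_gt0 : (0 < t)%N by rewrite gcdn_gt0 n_gt0 orbT.
have tn : (t %| n)%N by apply: dvdn_gcdr.
suff -> : 'C_(<[a]>)[b]%g = <[a ^+ (n %/ t)]>%g.
  by rewrite -orderE orderXdiv oa ?dvdn_div // divnA // mulKn.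
have fixE i : (a ^+ i \in 'C[b])%g = (n %/ t %| i)%N.
  have -> : (a ^+ i \in 'C[b])%g = (a ^+ (s * i) == a ^+ i)%g.
    rewrite expgM -ab -conjXg.
    by apply/cent1P/eqP=> [/commgP/conjg_fixP|/conjg_fixP/commgP].
  rewrite eq_expg_mod_order oa -(subnK s_gt0) mulnDl mul1n -{3}(add0n i) eqn_modDr.
  rewrite mod0n -/(dvdn n _) -{1}(divnK tn).
  rewrite -(divnK (dvdn_gcdl (s - 1) n)) -/t mulnAC dvdn_pmul2r //.
  rewrite Gauss_dvdr // /coprime -(eqn_pmul2r t_gt0) muln_gcdl mul1n.
  by rewrite !divnK ?dvdn_gcdl // gcdnC.
apply/setP=> x; apply/setIP/cycleP=> [[/cycleP[i ->]]|[i ->]].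
  by rewrite fixE => /dvdnP[k ->]; exists k; rewrite mulnC expgM.
by rewrite -expgM mem_cycle fixE dvdn_mulr.
Qed.

Theorem theorem1p1 (R : realType) (n s : nat)
    (gT : finGroupType) (G : {group gT}) :
  (3 <= n)%N -> (0 < s)%N -> (s <= n)%N -> coprime n s ->
  (s ^ 2 = 1 %[mod n])%N -> (s <> 1 %[mod n])%N ->
  (G \isog Grp (a : b : a ^+ n, b ^+ 2, b * a * b^-1 = a ^+ s))%g ->
  let tau := gcdn (s - 1) n in
  ((\dim (terwilliger_algebra R[i] G))%:R =
     (n ^ 2 + 3 * n * tau + 4 * tau ^ 2)%N%:R / 2%:R :> rat)%R.
Proof.
move=> n_ge3 s_gt0 _ _ s2 s1 isoG tau.
have [a [b [oa sAG iA Db ab]]] := presented_group_structure (ltnW n_ge3) s2 s1 isoG.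
have := dim_terwilliger_index2 R[i] sAG iA (cycle_abelian a) Db.
rewrite -orderE oa (card_cent1_cycle oa s_gt0 ab) -/tau => <-.
by rewrite natrM mulrC mulKf.
Qed.
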